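(* Let $\mathfrak{a}$ be a two-dimensional Lie subalgebra of $\mathfrak{d}$. Then $\mathfrak{a}$ is equal to either $\mathfrak{z}(m)$ for some $m\in\mathbb{Z}^{\times}$, or $\mathfrak{s}(\mu)$ for some $\mu=(n,k,\mathbf{r},\mathbf{a})\in\Sigma$.
   Context: $\mathbb{N}$ is the set of positive integers, $\mathbb{Z}^{\times}=\mathbb{Z}\setminus\{0\}$, $\mathbb{C}^{\times}=\mathbb{C}\setminus\{0\}$. $\mathfrak{d}$ is the centreless Virasoro algebra over $\mathbb{C}$, i.e. the Lie algebra of derivations of $\mathbb{C}[t^{\pm1}]$; with $\partial=t\frac{d}{dt}$, every element of $\mathfrak{d}$ is uniquely $F(t)\partial$ with $F(t)\in\mathbb{C}[t^{\pm1}]$, and $[F\partial,G\partial]=t(FG'-GF')\partial$. For $m\in\mathbb{Z}^{\times}$, $\mathfrak{z}(m)=\mathrm{span}_{\mathbb{C}}\{\partial,t^{m}\partial\}$. For $n,k\in\mathbb{N}$ with $n\geqslant k$, let $\Gamma(n,k)=\{(r_1,\ldots,r_n)\in\mathbb{N}^k\times\{-1\}^{n-k} : r_1+\cdots+r_n\geqslant k\}$. For $\mathbf{r}=(r_1,\ldots,r_n)\in\Gamma(n,k)$ put $|\mathbf{r}|=r_1+\cdots+r_n$, $V(\mathbf{r})=\{(a_1,\ldots,a_n)\in\mathbb{C}^n : \sum_{j=1}^n r_ja_j^i=0 \text{ for } i=1,\ldots,n-1\}$, and $V(\mathbf{r})^{\times}=V(\mathbf{r})\cap(\mathbb{C}^{\times})^n$.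 Let $\Sigma=\{(n,k,\mathbf{r},\mathbf{a}) : n,k\in\mathbb{N},\ n\geqslant k,\ \mathbf{r}\in\Gamma(n,k),\ \mathbf{a}\in V(\mathbf{r})^{\times}\}$. For $\mu=(n,k,\mathbf{r},\mathbf{a})\in\Sigma$ let $P_{\mu}(t)=(t-a_1)\cdots(t-a_n)\in\mathbb{C}[t]$, $Q_{\mu}(t)=t^{-|\mathbf{r}|}(t-a_1)^{r_1+1}\cdots(t-a_k)^{r_k+1}\in\mathbb{C}[t^{\pm1}]$, and $\mathfrak{s}(\mu)=\mathrm{span}_{\mathbb{C}}\{P_{\mu}(t)\partial,Q_{\mu}(t)\partial\}\subseteq\mathfrak{d}$. *)

(* Defs.v *)
From HB Require Import structures.
From mathcomp Require Import all_boot all_order all_algebra.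
From mathcomp Require Import ring.
From mathcomp Require Import finmap.
From mathcomp.multinomials Require Import monalg.
From mathcomp Require Import complex.
From mathcomp Require Import boolp classical_sets functions.
From mathcomp Require Import reals.

Set Implicit Arguments.
Unset Strict Implicit.
Unset Printing Implicit Defensive.

Import GRing.Theory Num.Theory.

Local Open Scope classical_set_scope.
Local Open Scope ring_scope.

(* The library has spans and free families only in a finite-dimensional
   [vectType]; here V may be infinite-dimensional. *)
Section Span.
Context (K : fieldType) (V : lmodType K).

Definition lspan (s : seq V) : set V :=
  [set v | exists c : 'I_(size s) -> K, v = \sum_i c i *: s`_i].

Definition lfree (s : seq V) : Prop :=
  forall c : 'I_(size s) -> K,
    \sum_i c i *: s`_i = 0 -> forall i, c i = 0.

Definition has_dim (W : set V) (d : nat) : Prop :=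
  exists s : seq V, [/\ size s = d, lfree s & W = lspan s].

End Span.

Section Derivations.
Context (K : fieldType) (A : comAlgType K).

Definition is_derivation (D : A -> A) : Prop :=
  linear D /\ forall f g, D (f * g) = D f * g + f * D g.

Definition derivation : {pred A -> A} := fun D => `[< is_derivation D >].

Lemma derivation_submod_closed : submod_closed derivation.
Proof.
split=> [|c D E].
  by apply/asboolP; split=> [a u v|f g]; rewrite /GRing.zero /=
    ?scaler0 ?mul0r ?mulr0 addr0.
move=> /asboolP[linD leibD] /asboolP[linE leibE]; apply/asboolP; split=> [a u v|f g].
  change (c *: D (a *: u + v) + E (a *: u + v) =
          a *: (c *: D u + E u) + (c *: D v + E v)).
  rewrite linD linE !scalerDr !scalerA (mulrC a c).
  by rewrite addrACA.
change (c *: D (f * g) + E (f * g) =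
        (c *: D f + E f) * g + f * (c *: D g + E g)).
rewrite leibD leibE !scalerDr mulrDl mulrDr.
by rewrite -!scalerAl -!scalerAr addrACA.
Qed.

HB.instance Definition _ :=
  GRing.isSubmodClosed.Build K (A -> A) derivation derivation_submod_closed.

Record der : Type := Der { der_fun :> A -> A; _ : der_fun \in derivation }.

HB.instance Definition _ := [isSub for der_fun].
HB.instance Definition _ := [Choice of der by <:].
HB.instance Definition _ := [SubChoice_isSubLmodule of der by <:].

Lemma derP (D : der) : is_derivation D.
Proof. by apply/asboolP; case: D. Qed.

Lemma lie_subproof (D E : der) :
  (fun f => D (E f) - E (D f)) \in derivation.
Proof.
have [linD leibD] := derP D.
have [linE leibE] := derP E.
have addF (F : der) u v : F (u + v) = F u + F v.
  by have [linF _] := derP F; have := linF 1 u v; rewrite !scale1r.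
apply/asboolP; split=> [a u v|f g].
  by rewrite linE linD linD linE scalerBr opprD addrACA.
by rewrite leibE leibD !addF !leibD !leibE; ring.
Qed.

Definition lie (D E : der) : der := Der (lie_subproof D E).

Lemma scale_der_subproof (F : A) (D : der) : (fun f => F * D f) \in derivation.
Proof.
have [linD leibD] := derP D.
apply/asboolP; split=> [a u v|f g]; first by rewrite linD mulrDr scalerAr.
by rewrite leibD; ring.
Qed.

Definition scale_der (F : A) (D : der) : der := Der (scale_der_subproof F D).

Definition lie_subalgebra (W : set der) : Prop :=
  [/\ W 0, forall (c : K) D E, W D -> W E -> W (c *: D + E)
    & forall D E, W D -> W E -> W (lie D E)].

End Derivations.

(* Laurent polynomials over C: finitely supported functions int -> C with the
   convolution product.  The ring structure of [monalg] does not apply, because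
   its monomials must have no units other than 1. *)
Definition laurent (C : fieldType) : Type := {malg C[int]}.

Section LaurentRing.
Context (C : fieldType).

HB.instance Definition _ := GRing.Lmodule.on (laurent C).

Implicit Types f g : laurent C.

Fact lmul_key : unit. Proof. exact: tt. Qed.

Definition lmul : laurent C -> laurent C -> laurent C :=
  locked_with lmul_key (fun f g =>
    \sum_(i <- msupp f) \sum_(j <- msupp g) << f@_i * g@_j *g (i + j) >>).

Lemma lmulE f g : lmul f g =
  \sum_(i <- msupp f) \sum_(j <- msupp g) << f@_i * g@_j *g (i + j) >>.
Proof. by rewrite [lmul]unlock. Qed.

Lemma lmulw (d1 d2 : {fset int}) f g :
  (msupp f `<=` d1)%fset -> (msupp g `<=` d2)%fset ->
  lmul f g = \sum_(i <- d1) \sum_(j <- d2) << f@_i * g@_j *g (i + j) >>.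
Proof.
move=> le1 le2; rewrite !lmulE (big_fset_incl _ le1) /=.
  apply: eq_bigr => i _; apply: big_fset_incl => // j _ /mcoeff_outdom ->.
  by rewrite mulr0 monalgU0.
move=> i _ /mcoeff_outdom fi.
by rewrite big1 // => j _; rewrite fi mul0r monalgU0.
Qed.

Let lmulC : commutative lmul.
Proof.
move=> f g; rewrite !lmulE exchange_big; apply: eq_bigr => j _.
by apply: eq_bigr => i _; rewrite mulrC addrC.
Qed.

Let lmulDl : left_distributive lmul +%R.
Proof.
move=> f1 f2 g; set d := (msupp f1 `|` msupp f2)%fset.
rewrite (@lmulw d (msupp g) (f1 + f2)) ?msuppD_le //.
rewrite (@lmulw d (msupp g) f1) ?fsubsetUl //.
rewrite (@lmulw d (msupp g) f2) ?fsubsetUr //.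
rewrite -big_split /=; apply: eq_bigr => i _.
by rewrite -big_split /=; apply: eq_bigr => j _; rewrite mcoeffD mulrDl monalgUD.
Qed.

Let lmulDr : right_distributive lmul +%R.
Proof. by move=> f g1 g2; rewrite lmulC lmulDl !(lmulC f). Qed.

Let lmul0 f : lmul 0 f = 0.
Proof. by rewrite !lmulE msupp0 big_seq_fset0. Qed.

Let lmulUU c1 c2 i j :
  lmul << c1 *g i >> << c2 *g j >> = << c1 * c2 *g (i + j) >>.
Proof.
by rewrite (lmulw msuppU_le msuppU_le) !big_seq_fset1 !mcoeffUU.
Qed.

Let lmulr0 f : lmul f 0 = 0.
Proof. by rewrite lmulC lmul0. Qed.

Lemma laurent_ind (P : laurent C -> Prop) :
  P 0 -> (forall f g, P f -> P g -> P (f + g)) ->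
  (forall c i, P << c *g i >>) -> forall f, P f.
Proof.
by move=> P0 PD PU f; rewrite (monalgE f); elim/big_ind: _ => // i _; exact: PU.
Qed.

Let lmulA : associative lmul.
Proof.
move=> f g h; elim/laurent_ind: f => [|f1 f2 IH1 IH2|c i].
- by rewrite !lmul0.
- by rewrite !lmulDl IH1 IH2.
elim/laurent_ind: g => [|g1 g2 IH1 IH2|d j].
- by rewrite !(lmul0, lmulr0).
- by rewrite !(lmulDl, lmulDr) IH1 IH2.
elim/laurent_ind: h => [|h1 h2 IH1 IH2|e k].
- by rewrite !lmulr0.
- by rewrite !lmulDr IH1 IH2.
by rewrite !lmulUU mulrA addrA.
Qed.

Let scaleU (c a : C) (i : int) :
  c *: (<< a *g i >> : laurent C) = << c * a *g i >>.
Proof. by apply/malgP => k; rewrite !mcoeffsE mulrnAr. Qed.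

Let lmul1 : left_id (<< 1 *g 0 >> : laurent C) lmul.
Proof.
elim/laurent_ind => [|f g IH1 IH2|c i]; first by rewrite lmulr0.
  by rewrite lmulDr IH1 IH2.
by rewrite lmulUU mul1r add0r.
Qed.

Let laurent1_neq0 : (<< 1 *g 0 >> : laurent C) != 0.
Proof.
by apply/eqP => /malgP/(_ 0)/eqP; rewrite mcoeffUU mcoeff0 oner_eq0.
Qed.

HB.instance Definition _ := GRing.Zmodule_isComNzRing.Build (laurent C)
  lmulA lmulC lmul1 lmulDl laurent1_neq0.

Let lscaleAl (c : C) f g : c *: (f * g) = (c *: f) * g.
Proof.
change (c *: lmul f g = lmul (c *: f) g).
elim/laurent_ind: f => [|f1 f2 IH1 IH2|a i].
- by rewrite scaler0 !lmul0 scaler0.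
- by rewrite scalerDr !lmulDl scalerDr IH1 IH2.
elim/laurent_ind: g => [|g1 g2 IH1 IH2|b j].
- by rewrite !lmulr0 scaler0.
- by rewrite !lmulDr scalerDr IH1 IH2.
by rewrite !(scaleU, lmulUU) mulrA.
Qed.

HB.instance Definition _ := GRing.Lmodule_isLalgebra.Build C (laurent C) lscaleAl.
HB.instance Definition _ := GRing.Lalgebra_isComAlgebra.Build C (laurent C).

End LaurentRing.

Section VectorFields.
Context (C : fieldType).

Definition tpow (m : int) : laurent C := << 1 *g m >>.

(* t d/dt, which multiplies t^m by m *)
Definition euler (f : laurent C) : laurent C :=
  [malg m in msupp f => m%:~R * f@_m].

Lemma mcoeff_euler f m : (euler f)@_m = m%:~R * f@_m.
Proof. by rewrite mcoeffE; case: msuppP => // _; rewrite mulr0. Qed.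

Lemma euler_linear : linear euler.
Proof.
move=> c f g; apply/malgP => m.
by rewrite !(mcoeff_euler, mcoeffD, mcoeffZ) mulrDr mulrCA.
Qed.

Lemma eulerD f g : euler (f + g) = euler f + euler g.
Proof. by have := euler_linear 1 f g; rewrite !scale1r. Qed.

Lemma euler0 : euler 0 = 0.
Proof. by apply/malgP => m; rewrite mcoeff_euler !mcoeff0 mulr0. Qed.

Lemma mulU (a b : C) i j :
  (<< a *g i >> : laurent C) * << b *g j >> = << a * b *g (i + j) >>.
Proof.
by rewrite {1}/GRing.mul /= (lmulw msuppU_le msuppU_le) !big_seq_fset1 !mcoeffUU.
Qed.

Lemma eulerU (a : C) i :
  euler << a *g i >> = << i%:~R * a *g i >>.
Proof.
apply/malgP => k; rewrite mcoeff_euler !mcoeffsE.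
by case: eqP => [->|_]; rewrite ?mulr0n ?mulr0.
Qed.

Lemma euler_subproof : euler \in @derivation C (laurent C).
Proof.
apply/asboolP; split=> [|f g]; first exact: euler_linear.
elim/laurent_ind: f => [|f1 f2 IH1 IH2|a i].
- by rewrite !(mul0r, euler0) addr0.
- by rewrite mulrDl !eulerD IH1 IH2 !mulrDl addrACA.
elim/laurent_ind: g => [|g1 g2 IH1 IH2|b j].
- by rewrite !(mulr0, euler0) addr0.
- by rewrite mulrDr !eulerD IH1 IH2 !mulrDr addrACA.
rewrite mulU !eulerU !mulU -monalgUD intrD; congr << _ *g _ >>; ring.
Qed.

Definition partial : der (laurent C) := Der euler_subproof.

(* The vector field F(t) d, with d = t d/dt; by [vfield_inj] and [vfield_surj]
   every derivation of C[t, t^-1] is of this form for a unique F. *)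
Definition vfield (F : laurent C) : der (laurent C) := scale_der F partial.

Lemma lie_vfield (F G : laurent C) :
  lie (vfield F) (vfield G) = vfield (F * euler G - G * euler F).
Proof.
apply/val_inj/funext => f /=.
have leibE g h : euler (g * h) = euler g * h + g * euler h.
  by have [_ /(_ g h)] := derP partial.
by rewrite !leibE; ring.
Qed.

Lemma vfield_inj : injective vfield.
Proof.
move=> F G /(congr1 (fun D : der (laurent C) => D (tpow 1))) /=.
rewrite eulerU mulr1 => /(congr1 ( *%R^~ (tpow (-1)))).
by rewrite -!mulrA mulU !mul1r addrN !mulr1.
Qed.

Lemma vfield_surj (D : der (laurent C)) : exists F, D = vfield F.
Proof.
pose F := tpow (-1) * D (tpow 1); exists F; apply/eqP; rewrite -subr_eq0.
have tK i j : tpow i * tpow j = tpow (i + j) by rewrite mulU mulr1.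
have Et : (D - vfield F) (tpow 1) = 0.
  change (D (tpow 1) - tpow (-1) * D (tpow 1) * euler (tpow 1) = 0).
  rewrite eulerU mulr1 mulrAC tK addNr.
  by rewrite -[tpow 0]/(1 : laurent C) mul1r subrr.
move: (D - vfield F) Et => E Et.
have [linE leibE] := derP E.
have E0 : E 0 = 0 by have := linE (-1) 0 0; rewrite scaler0 add0r scaleN1r addNr.
have E1 : E 1 = 0.
  have := leibE 1 1; rewrite !mulr1 mul1r.
  by rewrite -[X in X = _]addr0 => /addrI/esym.
have En (n : nat) : E (tpow n) = 0.
  by elim: n => // n IH; rewrite -addn1 PoszD -tK leibE IH Et mul0r mulr0 addr0.
have Ei (i : int) : E (tpow i) = 0.
  case: i => n; first exact: En.
  have := leibE (tpow (Negz n)) (tpow n.+1).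
  rewrite tK NegzE addNr -[tpow 0]/(1 : laurent C) E1 En mulr0 addr0.
  move=> /(congr1 ( *%R^~ (tpow (- n.+1%:Z)))).
  by rewrite mul0r -mulrA tK addrN mulr1.
apply/eqP/val_inj/funext => f /=; change (E f = 0).
elim/laurent_ind: f => [//|f g IHf IHg|c i].
  by have := linE 1 f g; rewrite !scale1r IHf IHg addr0.
have -> : << c *g i >> = c *: tpow i + 0.
  by rewrite addr0; apply/malgP => k; rewrite !mcoeffsE mulrnAr mulr1.
by rewrite linE Ei scaler0 add0r E0.
Qed.

End VectorFields.

Arguments partial {C}.

Section Subalgebras.
Context (C : fieldType).

Definition z_alg (m : int) : set (der (laurent C)) :=
  lspan [:: partial; vfield (tpow C m)].

Definition weight n (r : 'rV[int]_n) : int := \sum_j r 0 j.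

(* Indices are 0-based: r_1, ..., r_k are the entries j < k. *)
Definition Gamma (n k : nat) : set 'rV[int]_n :=
  [set r : 'rV[int]_n | [/\ forall j : 'I_n, (j < k)%N -> 0 < r 0 j,
               forall j : 'I_n, (k <= j)%N -> r 0 j = -1
             & k%:Z <= weight r]].

Definition Vset n (r : 'rV[int]_n) : set 'rV[C]_n :=
  [set a : 'rV[C]_n | forall i : nat, (1 <= i <= n.-1)%N ->
             \sum_j (r 0 j)%:~R * a 0 j ^+ i = 0].

Definition Vtimes n (r : 'rV[int]_n) : set 'rV[C]_n :=
  Vset r `&` [set a : 'rV[C]_n | forall j, a 0 j != 0].

Record Sigma := {
  sn : nat;
  sk : nat;
  sr : 'rV[int]_sn;
  sa : 'rV[C]_sn;
  sk_gt0 : (0 < sk)%N;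
  sk_le_sn : (sk <= sn)%N;
  sr_Gamma : Gamma sk sr;
  sa_V : Vtimes sr sa
}.

Definition Pmu (mu : Sigma) : laurent C :=
  \prod_(j < sn mu) (tpow C 1 - (sa mu 0 j)%:A).

(* For j < k the exponent r_j + 1 is positive, so [absz] is just its
   conversion to nat. *)
Definition Qmu (mu : Sigma) : laurent C :=
  tpow C (- weight (sr mu)) *
  \prod_(j < sn mu | (j < sk mu)%N)
    (tpow C 1 - (sa mu 0 j)%:A) ^+ absz (sr mu 0 j + 1).

Definition s_alg (mu : Sigma) : set (der (laurent C)) :=
  lspan [:: vfield (Pmu mu); vfield (Qmu mu)].

End Subalgebras.

(* Main.v *)
Require Import Defs.
From HB Require Import structures.
From mathcomp Require Import all_boot all_order all_algebra.
From mathcomp Require Import ring zify.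
From mathcomp.multinomials Require Import monalg.
From mathcomp Require Import complex boolp classical_sets reals.

(* Since [F d, G d] = 0 forces G / F to be constant, the subalgebra is not
   abelian and has a basis F, G with [F d, G d] = lam G d, lam <> 0; F may still
   be changed by a multiple of G, so its order at 0 can be made different from
   that of G = t^j g.  Comparing lowest coefficients, F = f is then a polynomial
   with f(0) <> 0, and comparing top ones, either f is constant, which makes G
   a monomial, or deg f = j + deg g.  In the latter case, if j > 0, cancelling
   the top coefficient of F against G makes F constant.  If j = -w < 0, write
   the bracket relation as t u' / u = lam / f with u = G / F: a logarithmic
   derivative has only simple poles, so the roots b of f are simple, those of g
   are among them, and r = (multiplicity of b in g) - 1 equals lam / (b f'(b)).
   Lagrange interpolation at the roots of f turns these values of r into the
   equations of V(r), and |r| = deg g - deg f = w.  Finally k <= w, because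
   cancelling the top coefficient of F against G leaves t^-w times a nonzero
   polynomial of degree <= w that vanishes at the k distinct roots of g. *)

Set Implicit Arguments.
Unset Strict Implicit.
Unset Printing Implicit Defensive.

Import Order.TTheory GRing.Theory Num.Theory.
Local Open Scope ring_scope.

(** * Polynomial solutions of the bracket equation *)

Lemma coefM_top (R : nzRingType) (p q : {poly R}) m n :
  (size p <= m.+1)%N -> (size q <= n.+1)%N -> (p * q)`_(m + n) = p`_m * q`_n.
Proof.
move=> sp sq; rewrite coefM; have mn : (m < (m + n).+1)%N by rewrite ltnS leq_addr.
rewrite (bigD1 (Ordinal mn)) //= addKn big1 ?addr0 // => k.
rewrite -val_eqE /= neq_ltn => /orP [km|mk].
  by rewrite [q`_ _]nth_default ?mulr0 // (leq_trans sq) // ltn_subRL ltn_add2r.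
by rewrite nth_default ?mul0r // (leq_trans sp).
Qed.

(** * Lagrange interpolation of powers *)

Section LagrangeIdentity.
Context (F : fieldType).

(** Interpolating ['X^k] at the nodes [rs] gives back ['X^k]; the sum is the coefficient of the
    interpolant in degree [size rs - 1], which exceeds [k]. *)
Lemma lagrange_sum_exp_eq0 (rs : seq F) k :
  uniq rs -> (k.+1 < size rs)%N ->
  \sum_(b <- rs) b ^+ k / (\prod_(c <- rem b rs) (b - c)) = 0.
Proof.
move=> uniq_rs ltk.
pose l b := \prod_(c <- rem b rs) ('X - c%:P) : {poly F}.
have lE b : (l b).[b] = \prod_(c <- rem b rs) (b - c).
  by rewrite horner_prod; apply: eq_bigr => c _; rewrite hornerXsubC.
have size_l b : b \in rs -> size (l b) = size rs.
  move=> brs; rewrite size_prod_XsubC size_rem // prednK //.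
  by case: (rs) brs.
have l_lead b : b \in rs -> (l b)`_(size rs).-1 = 1.
  by move=> brs; rewrite -(size_l b) // -/(lead_coef _) lead_coef_prod_XsubC.
have lb0 b : b \in rs -> (l b).[b] != 0.
  move=> brs; rewrite lE prodf_seq_neq0; apply/allP => c; rewrite mem_rem_uniq //.
  by rewrite inE /= subr_eq0 eq_sym => /andP[].
have lc0 b c : c \in rs -> c != b -> (l b).[c] = 0.
  move=> crs cb; apply/rootP; rewrite root_prod_XsubC mem_rem_uniq //.
  by rewrite inE cb.
pose L := \sum_(b <- rs) (b ^+ k / (l b).[b]) *: l b.
have L_Xn : L = 'X^k.
  have roots : all (root (L - 'X^k)) rs.
    apply/allP => b brs; apply/rootP; rewrite hornerD hornerN hornerXn.
    rewrite horner_sum (bigD1_seq b) //= hornerZ divfK ?lb0 //.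
    rewrite big1_seq ?addr0 ?subrr // => c /andP[cb _].
    by rewrite hornerZ (lc0 c b) ?mulr0 1?eq_sym.
  have size_le : (size (L - 'X^k)%R <= size rs)%N.
    rewrite (leq_trans (size_polyD _ _)) // size_polyN geq_max.
    rewrite size_polyXn (ltnW ltk) andbT.
    rewrite /L big_seq; apply: (leq_trans (size_sum _ _ _)).
    apply/bigmax_leqP_seq => b _ brs; rewrite -(size_l b) //.
    exact: size_scale_leq.
  apply/eqP; rewrite -subr_eq0; apply/negPn/negP => neq0.
  by have := max_poly_roots neq0 roots uniq_rs; rewrite ltnNge size_le.
have top0 : L`_(size rs).-1 = 0.
  by rewrite L_Xn coefXn gtn_eqF //; case: (size rs) ltk.
rewrite -[RHS]top0 coef_sum !big_seq; apply: eq_bigr => b brs.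
by rewrite coefZ l_lead // mulr1 lE.
Qed.

End LagrangeIdentity.

(** * Degrees and roots in the bracket equation *)

Section Equation.
Context (C : numFieldType).
Implicit Types (f g : {poly C}) (j : int) (lam b : C).

Lemma coef_mulX_deriv f k : ('X * f^`())`_k = k%:R * f`_k.
Proof. by rewrite coefXM coef_deriv mulr_natl; case: k. Qed.

Lemma size_mulX_deriv f n : (size f <= n -> size ('X * f^`())%R <= n)%N.
Proof.
move=> /leq_sizeP fn; apply/leq_sizeP => k nk.
by rewrite coef_mulX_deriv fn // mulr0.
Qed.

(** The operator [X d/dX] multiplies a coefficient of degree [k] by [k], and in degree [n + m] only
    [f]_n[and]g[_m] meet. *)
Lemma coef_bracket_top f g m n : (size f <= n.+1)%N -> (size g <= m.+1)%N ->
  ('X * (f * g^`() - g * f^`()))`_(n + m) = (m%:R - n%:R) * (f`_n * g`_m).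
Proof.
move=> fn gm.
rewrite (_ : 'X * _ = f * ('X * g^`()) - ('X * f^`()) * g); last by ring.
rewrite coefB !coefM_top ?size_mulX_deriv // !coef_mulX_deriv; ring.
Qed.

(* [f d, t^j g d] = lam t^j g d, divided by t^j. *)
Definition bracket_eq j f g lam :=
  j%:~R *: (f * g) + 'X * (f * g^`() - g * f^`()) = lam *: g.

(** In degree [deg f + deg g] the right-hand side has no term, because [f] is not constant. The
    left-hand coefficient is [j + deg g - deg f] times the leading coefficients, so this integer
    vanishes. *)
Lemma bracket_eq_size j f g lam : f != 0 -> g != 0 -> (1 < size f)%N ->
  bracket_eq j f g lam -> (size f)%:Z = j + (size g)%:Z.
Proof.
move=> f0 g0 f1 e.
have sf : size f = (size f).-1.+1 by rewrite prednK // ltnW.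
have sg : size g = (size g).-1.+1 by rewrite prednK // size_poly_gt0.
have := congr1 (fun p : {poly C} => p`_((size f).-1 + (size g).-1)) e.
rewrite /= coefD coef_bracket_top -?sf -?sg // !coefZ coefM_top -?sf -?sg //.
rewrite [in RHS]nth_default; last first.
  by rewrite [X in (X <= _)%N]sg -add1n leq_add2r -ltnS -sf.
rewrite mulr0 -mulrDl => /eqP; rewrite mulf_eq0 mulf_eq0 !lead_coef_eq0.
rewrite (negPf f0) (negPf g0) !orbF !pmulrn -intrB -intrD intr_eq0 => /eqP top0.
have : j + ((size g).-1%:Z - (size f).-1%:Z) = 0 := top0.
move: (size f) (size g) sf sg {f1 e top0}; lia.
Qed.



(** The extra factor [h] keeps the exponent [m - 1] out of the formula, so that [m = 0] is covered
    too. *)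
Lemma XsubC_mul_deriv_exp b g m (h := 'X - b%:P) :
  h * (g * h ^+ m)^`() = h ^+ m * (h * g^`() + m%:R *: g).
Proof.
rewrite derivM deriv_exp derivB derivX derivC subr0 mul1r scaler_nat.
case: m => [|m] /=; first by rewrite !mulr0n; ring.
rewrite exprS; ring.
Qed.

(* The derivative of f * ('X - b) at b is f(b); as lam <> 0, it follows that b
   is a simple root of f * ('X - b). *)
Lemma bracket_eq_mult j f g lam b m :
  bracket_eq j (f * ('X - b%:P)) (g * ('X - b%:P) ^+ m) lam -> g.[b] != 0 ->
  (m%:R - 1) * (b * f.[b]) = lam.
Proof.
rewrite /bracket_eq; set h := 'X - b%:P => e gb0.
have h0 : h ^+ m != 0 by rewrite expf_neq0 // polyXsubC_eq0.
have {}e : j%:~R *: (f * h * g) + 'X * (f * (h * g^`() + m%:R *: g)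
    - g * (f^`() * h + f)) = lam *: g.
  apply: (mulIf h0); rewrite -scalerAl -e mulrDl -scalerAl !mulrA -!mulrA.
  congr (_ + _ * _); rewrite -[f * (h * _)]/(f * (h * _)) XsubC_mul_deriv_exp.
  by rewrite (derivM f) /h derivB derivX derivC -/h; ring.
have := congr1 (fun p => p.[b]) e; 
rewrite /= !(hornerD, hornerN, hornerM, hornerZ, hornerX, hornerC) subrr.
rewrite !(mulr0, mul0r, add0r) => eb.
by apply: (mulIf gb0); rewrite -eb; ring.
Qed.

(** Multiply the equation by [h], cancel [h ^+ m.+1] and evaluate at [b]: all that survives is
    [(m + 1) b f(b) g(b) = 0]. *)
Lemma bracket_eq_root j f g lam b m :
  bracket_eq j f (g * ('X - b%:P) ^+ m.+1) lam -> g.[b] != 0 -> b != 0 ->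
  f.[b] = 0.
Proof.
rewrite /bracket_eq; set h := 'X - b%:P => e gb0 b0.
have h0 : h ^+ m.+1 != 0 by rewrite expf_neq0 // polyXsubC_eq0.
have {}e : j%:~R *: (f * g * h) + 'X * (f * (h * g^`() + m.+1%:R *: g)
    - g * h * f^`()) = lam *: (g * h).
  apply: (mulIf h0).
  transitivity (h * (lam *: (g * h ^+ m.+1))); last by rewrite -!mul_polyC; ring.
  rewrite -e; set D := (g * h ^+ m.+1)^`().
  have hD : h * D = h ^+ m.+1 * (h * g^`() + m.+1%:R *: g).
    exact: XsubC_mul_deriv_exp.
  transitivity (j%:~R *: (f * (h * (g * h ^+ m.+1))) +
    'X * (f * (h * D) - h * (g * h ^+ m.+1) * f^`())).
    by rewrite hD -!mul_polyC; ring.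
  by rewrite -!mul_polyC; ring.
have := congr1 (fun p => p.[b]) e.
rewrite /= !(hornerD, hornerN, hornerM, hornerZ, hornerX, hornerC) subrr.
rewrite !(mulr0, mul0r, add0r, subr0) => /eqP.
by rewrite !mulf_eq0 pnatr_eq0 (negPf b0) (negPf gb0) /= !orbF => /eqP.
Qed.

End Equation.

(** * Roots counted with multiplicity *)

Lemma sum_count_undup (T : eqType) (r : seq T) :
  (\sum_(x <- undup r) count_mem x r = size r)%N.
Proof.
rewrite -sum1_size -[RHS]big_undup_iterop_count; apply: eq_bigr => x _.
by rewrite Monoid.iteropE iter_addn_0 mul1n.
Qed.

Lemma prod_XsubC_split (R : comNzRingType) (cs : seq R) b :
  \prod_(c <- cs) ('X - c%:P) =
  \prod_(c <- cs | c != b) ('X - c%:P) * ('X - b%:P) ^+ count_mem b cs.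
Proof.
rewrite (bigID (pred1 b)) /= mulrC; congr (_ * _).
rewrite (eq_bigr (fun=> 'X - b%:P)) => [|c /eqP->//].
by rewrite big_const_seq iter_mulr_1.
Qed.

(** * Cancelling the top coefficient *)

Section BracketShift.
Context (C : numFieldType).
Implicit Types (f g : {poly C}).

(** The terms in [x] cancel, since [g] commutes with itself; the derivative of ['X^w] supplies the
    term with factor [-w]. The result is the equation multiplied by ['X^w]. *)
Lemma bracket_eq_shift w f g (lam x : C) : bracket_eq (- w%:Z) f g lam ->
  'X * (('X^w * f - x *: g) * g^`() - g * ('X^w * f - x *: g)^`()) =
  lam *: ('X^w * g).
Proof.
rewrite /bracket_eq => e.
rewrite scalerAr -e derivB derivZ derivM derivXn -!mul_polyC.
rewrite rmorphMz rmorphN /= -mulr_natl.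
case: w {e} => [|w]; first by ring.
rewrite exprS /=; ring.
Qed.

(* In terms of F = f and G = t^-w g, a combination of F and G whose top
   coefficient vanishes is t^-w times a polynomial of degree <= w. *)
Lemma bracket_eq_cancel_top w f g (lam : C) : (0 < w)%N -> (1 < size f)%N ->
  g.[0] != 0 -> bracket_eq (- w%:Z) f g lam ->
  let h := 'X^w * f - (lead_coef f / lead_coef g) *: g in
  h != 0 /\ (size h <= w.+1)%N.
Proof.
move=> w0 f1 g00 e; set x := _ / _ => h.
have f0 : f != 0 by rewrite -size_poly_gt0 ltnW.
have g0 : g != 0 by apply: contraNneq g00 => ->; rewrite horner0.
have x0 : x != 0 by rewrite mulf_neq0 ?invr_eq0 ?lead_coef_eq0.
(* As [w > 0], the value of [h] at 0 is [- x * g.[0]]. *)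
have h0 : h != 0.
  apply: contraNneq (mulf_neq0 x0 g00) => /(congr1 (fun p => p.[0])).
  rewrite /= hornerD hornerN hornerM hornerXn expr0n hornerZ horner0 gtn_eqF //.
  by rewrite mul0r add0r => /eqP; rewrite oppr_eq0.
have := bracket_eq_size f0 g0 f1 e => sfg.
(* By the degree relation ['X^w * f] and [g] have equal degree, and [x] matches their leading
   coefficients. *)
have size_h : (size h < size g)%N.
  have sg : size g = (w + size f)%N by move: (size f) (size g) sfg; lia.
  have g_gt0 : (0 < size g)%N by rewrite size_poly_gt0.
  rewrite -(prednK g_gt0) ltnS; apply/leq_sizeP => k gk.
  have [->|kg] := eqVneq k (size g).-1.
    rewrite coefB coefXnM coefZ -/(lead_coef g) divfK ?lead_coef_eq0 //.
    rewrite ltnNge sg (_ : (w <= (w + size f).-1)%N) /=; last first.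
      by move: (size f) f1; lia.
    rewrite (_ : ((w + size f).-1 - w)%N = (size f).-1) ?subrr //.
    by move: (size f) f1; lia.
  rewrite nth_default //; apply: leq_trans (size_polyD _ _) _.
  rewrite size_polyN geq_max (leq_trans (size_polyMleq _ _)) ?size_polyXn /=; last first.
    by move: (size f) (size g) sg gk kg; lia.
  by rewrite (leq_trans (size_scale_leq _ _)) //; move: (size g) gk kg; lia.
(* If [deg h > w], the right-hand side of the shifted equation has no term in degree
   [deg h + deg g]. The left-hand coefficient there is a nonzero multiple of [deg g - deg h], which
   is positive. *)
split=> //; rewrite leqNgt; apply/negP => wh.
have sh : size h = (size h).-1.+1 by move: (size h) wh; lia.
have sg : size g = (size g).-1.+1 by move: (size h) (size g) size_h; lia.
have := congr1 (fun p : {poly C} => p`_((size h).-1 + (size g).-1))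
  (bracket_eq_shift x e).
rewrite /= coef_bracket_top -?sh -?sg // coefZ coefXnM.
rewrite ifF; last by move: (size h) wh; lia.
rewrite [in RHS]nth_default ?mulr0; last by move: (size h) (size g) wh size_h; lia.
move/eqP; rewrite !mulf_eq0 !lead_coef_eq0 (negPf h0) (negPf g0) !orbF.
by rewrite subr_eq0 eqr_nat; move: (size h) (size g) wh size_h; lia.
Qed.

End BracketShift.

(** * The roots of [f] and [g] *)

Section Roots.
Context (C : numClosedFieldType).
Implicit Types (f g : {poly C}) (lam b : C).

(* [s1] lists the roots a_1, ..., a_k and [s2] the roots a_(k+1), ..., a_n;
   for b = a_j, [mu b] is r_j + 1. *)
Lemma bracket_eq_roots w f g lam : (0 < w)%N -> lam != 0 ->
  f.[0] != 0 -> g.[0] != 0 -> (1 < size f)%N -> bracket_eq (- w%:Z) f g lam ->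
  exists (s1 s2 : seq C) (mu : C -> nat),
  [/\ f = lead_coef f *: \prod_(b <- s1 ++ s2) ('X - b%:P),
      g = lead_coef g *: \prod_(b <- s1) ('X - b%:P) ^+ mu b,
      0 \notin s1 ++ s2, {in s1, forall b, (1 < mu b)%N}
    & {in s2, forall b, mu b = 0%N}] /\
  [/\ \sum_(b <- s1 ++ s2) ((mu b)%:Z - 1) = w%:Z, (size s1 <= w)%N
    & forall i, (1 <= i <= (size (s1 ++ s2)).-1)%N ->
      \sum_(b <- s1 ++ s2) ((mu b)%:Z - 1)%:~R * b ^+ i = 0].
Proof.
move=> w_gt0 lam0 f00 g00 f1 e.
have f0 : f != 0 by apply: contraNneq f00 => ->; rewrite horner0.
have g0 : g != 0 by apply: contraNneq g00 => ->; rewrite horner0.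
have [rs fE] := closed_field_poly_normal f.
have [cs gE] := closed_field_poly_normal g.
have lf0 : lead_coef f != 0 by rewrite lead_coef_eq0.
have lg0 : lead_coef g != 0 by rewrite lead_coef_eq0.
have rootf b : (f.[b] == 0) = (b \in rs).
  by rewrite fE hornerZ mulf_eq0 (negPf lf0) -rootE root_prod_XsubC.
have rootg b : (g.[b] == 0) = (b \in cs).
  by rewrite gE hornerZ mulf_eq0 (negPf lg0) -rootE root_prod_XsubC.
have cs_neq0 b : b \in cs -> b != 0.
  by apply: contraTneq => ->; rewrite -rootg.
pose mu b := count_mem b cs.
(* [g1 b] is [g] without any of its factors at [b]. For a root [b] of [f], [f1_ b] below is [f]
   without one such factor, so its value at [b] is [f'(b)]. *)
pose g1 b := lead_coef g *: \prod_(c <- cs | c != b) ('X - c%:P).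
have g1E b : g = g1 b * ('X - b%:P) ^+ mu b.
  by rewrite {1}gE (prod_XsubC_split _ b) scalerAl.
have g1b0 b : (g1 b).[b] != 0.
  rewrite hornerZ mulf_neq0 // horner_prod prodf_seq_neq0.
  by apply/allP => c _; apply/implyP => cb; rewrite hornerXsubC subr_eq0 eq_sym.
pose f1_ b := lead_coef f *: \prod_(c <- rem b rs) ('X - c%:P).
have f1E b : b \in rs -> f = f1_ b * ('X - b%:P).
  by move=> brs; rewrite [LHS]fE (big_rem b brs) /= -scalerAl mulrC.
have multE b : b \in rs -> ((mu b)%:R - 1) * (b * (f1_ b).[b]) = lam.
  by move=> brs; apply: bracket_eq_mult (g1b0 b); rewrite -g1E -f1E //; exact: e.
have f1b0 b : b \in rs -> (f1_ b).[b] != 0.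
  move=> brs; apply: contraNneq lam0 => fb0.
  by rewrite -(multE b) // fb0 !mulr0.
have mu_neq1 b : b \in rs -> mu b != 1%N.
  move=> brs; apply: contraNneq lam0 => mu1.
  by rewrite -(multE b) // mu1 subrr mul0r.
(* The cofactor [f1_ b] does not vanish at [b], so [rs] holds no second copy of [b]. *)
have uniq_rs : uniq rs.
  apply: count_mem_uniq => b; have [brs|/count_memPn->//] := boolP (b \in rs).
  have /permP -> := perm_to_rem brs; rewrite /= eqxx; congr (_ + _)%N.
  apply/count_memPn; have := f1b0 _ brs.
  by rewrite hornerZ mulf_eq0 (negPf lf0) -rootE root_prod_XsubC.
have cs_rs b : b \in cs -> b \in rs.
  move=> bcs; rewrite -rootf; apply/eqP.
  have mu_gt0 : mu b = (mu b).-1.+1 by rewrite prednK // -has_count has_pred1.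
  apply: (@bracket_eq_root _ (- w%:Z) _ (g1 b) lam _ (mu b).-1 _ (g1b0 b));
    last exact: cs_neq0.
  by rewrite -mu_gt0 -g1E; exact: e.
pose s1 := [seq b <- rs | b \in cs]; pose s2 := [seq b <- rs | b \notin cs].
have perm_rs : perm_eq (s1 ++ s2) rs by rewrite perm_filterC.
have perm_cs : perm_eq (undup cs) s1.
  apply: uniq_perm; rewrite ?undup_uniq ?filter_uniq // => b.
  rewrite mem_undup mem_filter; case: (boolP (b \in cs)) => //= /cs_rs.
  by move=> ->.
exists s1, s2, mu; split; split.
- by rewrite (perm_big _ perm_rs).
- by rewrite -(perm_big _ perm_cs) prodr_undup_exp_count.
- by rewrite (perm_mem perm_rs) -rootf.
- move=> b; rewrite mem_filter => /andP[bcs /mu_neq1].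
  have : (0 < mu b)%N by rewrite -has_count has_pred1.
  by case: (mu b) => [|[]].
- by move=> b; rewrite mem_filter => /andP[/count_memPn].
- have sum_mu : (\sum_(b <- s1 ++ s2) mu b = size cs)%N.
    rewrite big_cat /= [X in (_ + X)%N]big1_seq => [|b /andP[_]]; last first.
      by rewrite mem_filter => /andP[/count_memPn].
    by rewrite addn0 -(perm_big _ perm_cs) /= sum_count_undup.
  have sum1 s : \sum_(b <- s : seq C) (1 : int) = (size s)%:Z.
    by rewrite -sum1_size (big_morph Posz PoszD erefl).
  rewrite sumrB sum1 (perm_size perm_rs) -(big_morph Posz PoszD erefl) sum_mu.
  have := bracket_eq_size f0 g0 f1 e.
  rewrite fE gE !size_scale // !size_prod_XsubC => sizes.
  change ((size cs)%:Z - (size rs)%:Z = w%:Z).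
  by move: (size rs) (size cs) sizes; clear; lia.
(* The elements of [s1] are distinct common roots of [f] and [g], hence roots of the nonzero
   combination [h] of degree at most [w]. *)
- have [h0 size_h] := bracket_eq_cancel_top w_gt0 f1 g00 e.
  rewrite -ltnS; apply: leq_trans size_h; apply: max_poly_roots h0 _ _.
    apply/allP => b; rewrite mem_filter -rootf -rootg => /andP[/eqP gb /eqP fb].
    by rewrite rootE hornerD hornerN hornerM hornerZ fb gb !mulr0 subr0.
  by rewrite filter_uniq.
move=> i; rewrite (perm_size perm_rs) => /andP[i_gt0 ltis].
(* The exponent is [i - 1] because [mu b - 1 = lam / (b f'(b))] uses up one factor [b], and [f'(b)]
   is [lead_coef f] times the product of the [b - c]. *)
have lagrange0 : \sum_(b <- rs) b ^+ i.-1 / (\prod_(c <- rem b rs) (b - c)) = 0.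
  by apply: lagrange_sum_exp_eq0 => //; move: (size rs) ltis i_gt0; clear; lia.
rewrite (perm_big _ perm_rs) /= -[RHS](mulr0 (lam / lead_coef f)) -[in RHS]lagrange0.
rewrite mulr_sumr !big_seq; apply: eq_bigr => b brs.
rewrite -(multE b) // hornerZ horner_prod.
under eq_bigr do rewrite hornerXsubC.
rewrite intrB -pmulrn -{1}(prednK i_gt0) exprS.
have := f1b0 b brs; rewrite hornerZ mulf_eq0 negb_or horner_prod.
under eq_bigr do rewrite hornerXsubC.
by case/andP => _ P0; field; rewrite P0.
Qed.

End Roots.

(** * Laurent polynomials and vector fields *)

Section LaurentPoly.
Context (C : fieldType).
Implicit Types (f g p q : {poly C}) (F G : laurent C) (i j : int) (m n : nat).

Lemma tpowD i j : tpow C (i + j) = tpow C i * tpow C j.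
Proof. by rewrite mulU mulr1. Qed.

Lemma tpow0 : tpow C 0 = 1.
Proof. by []. Qed.

Lemma tpowX n : tpow C 1 ^+ n = tpow C n.
Proof. by elim: n => // n IHn; rewrite exprS IHn -tpowD. Qed.

Lemma tpowNK i F : tpow C (- i) * (tpow C i * F) = F.
Proof. by rewrite mulrA -tpowD addNr tpow0 mul1r. Qed.

Lemma tpow_inj i : injective ( *%R (tpow C i)).
Proof. by move=> F G /(congr1 ( *%R (tpow C (- i)))); rewrite !tpowNK. Qed.

Definition lpoly : {poly C} -> laurent C := horner_alg (tpow C 1).
HB.instance Definition _ := GRing.RMorphism.on lpoly.

Lemma lpolyX : lpoly 'X = tpow C 1.
Proof. exact: horner_algX. Qed.

Lemma lpolyC (c : C) : lpoly c%:P = c%:A.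
Proof. exact: horner_algC. Qed.

Lemma lpolyD p q : lpoly (p + q) = lpoly p + lpoly q.
Proof. exact: rmorphD. Qed.

Lemma lpolyB p q : lpoly (p - q) = lpoly p - lpoly q.
Proof. exact: rmorphB. Qed.

Lemma lpolyM p q : lpoly (p * q) = lpoly p * lpoly q.
Proof. exact: rmorphM. Qed.

Lemma lpolyZ (c : C) p : lpoly (c *: p) = c *: lpoly p.
Proof. by rewrite -mul_polyC rmorphM /= lpolyC mulr_algl. Qed.

Lemma lpolyXn n : lpoly 'X^n = tpow C n.
Proof. by rewrite rmorphXn /= lpolyX tpowX. Qed.

Lemma mcoeff_tpow i j : (tpow C i)@_j = (i == j)%:R.
Proof. by rewrite mcoeffU. Qed.

Lemma mcoeff_lpoly p n : (lpoly p)@_(n%:Z) = p`_n.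
Proof.
rewrite -{1}[p]coefK poly_def rmorph_sum /= raddf_sum /=.
under eq_bigr do rewrite lpolyZ lpolyXn mcoeffZ mcoeff_tpow eqz_nat.
case: (ltnP n (size p)) => np.
  rewrite (bigD1 (Ordinal np)) //= eqxx mulr1 big1 ?addr0 // => k kn.
  by rewrite (_ : (_ == _) = false) ?mulr0 //; apply/negbTE.
rewrite nth_default // big1 // => k _.
by rewrite ltn_eqF ?mulr0 // (leq_trans (ltn_ord k)).
Qed.

Lemma lpoly_inj : injective lpoly.
Proof.
by move=> p q pq; apply/polyP => n; rewrite -!mcoeff_lpoly pq.
Qed.

Lemma euler_tpow i : euler (tpow C i) = i%:~R *: tpow C i.
Proof.
rewrite eulerU; apply/malgP => k.
by rewrite mcoeffZ !mcoeffsE mulr1 -[LHS]mulr_natr.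
Qed.

Lemma eulerM F G : euler (F * G) = euler F * G + F * euler G.
Proof. by have [_ /(_ F G)] := derP (@partial C). Qed.

Lemma eulerZ (c : C) F : euler (c *: F) = c *: euler F.
Proof. by have := euler_linear c F 0; rewrite euler0 !addr0. Qed.

Lemma euler_lpoly p : euler (lpoly p) = lpoly ('X * p^`()).
Proof.
elim/poly_ind: p => [|p c IHp].
  by rewrite linear0 mulr0 rmorph0 euler0.
rewrite lpolyD lpolyM lpolyX lpolyC eulerD eulerM eulerZ -tpow0.
rewrite !euler_tpow IHp derivD derivM derivX derivC.
rewrite scale0r scaler0 scale1r !addr0 mulr1 mulrDr lpolyD !lpolyM lpolyX.
ring.
Qed.

Lemma laurent_shift F : exists n p, F = tpow C (- n%:Z) * lpoly p.
Proof.
elim/laurent_ind: F => [|F G [n [p ->]] [m [q ->]]|c [n|n]].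
- by exists 0%N, 0; rewrite [lpoly 0]rmorph0 mulr0.
- exists (n + m)%N, (p * 'X^m + q * 'X^n).
  rewrite lpolyD !lpolyM !lpolyXn PoszD opprD tpowD mulrDr.
  congr (_ + _); rewrite -mulrA; first by rewrite [lpoly p * _]mulrC tpowNK.
  by rewrite [tpow C (- n%:Z) * _]mulrCA [lpoly q * _]mulrC tpowNK.
- exists 0%N, (c *: 'X^n); rewrite lpolyZ lpolyXn tpow0 mul1r.
  by apply/malgP => k; rewrite mcoeffZ !mcoeffsE -[LHS]mulr_natr.
- exists n.+1, c%:P; rewrite lpolyC -NegzE -scalerAr mulr1.
  by apply/malgP => k; rewrite mcoeffZ !mcoeffsE -[LHS]mulr_natr.
Qed.

Lemma polyX_factor p : p != 0 -> exists n q, p = q * 'X^n /\ q.[0] != 0.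
Proof.
move=> p0; have [n [q]] := multiplicity_XsubC p 0.
by rewrite p0 subr0 /= => q0 ->; exists n, q; split.
Qed.

Lemma laurent_factor F : F != 0 -> exists i p, F = tpow C i * lpoly p /\ p.[0] != 0.
Proof.
have [n [p ->]] := laurent_shift F => Fn0.
have p0 : p != 0 by apply: contraNneq Fn0 => ->; rewrite rmorph0 mulr0.
have [m [q [-> q0]]] := polyX_factor p0.
by exists (- n%:Z + m%:Z), q; rewrite lpolyM lpolyXn tpowD -mulrA [_ * tpow C m]mulrC.
Qed.

Lemma laurent_factor_uniq i j p q :
  tpow C i * lpoly p = tpow C j * lpoly q -> p.[0] != 0 -> q.[0] != 0 -> i = j.
Proof.
wlog le_ij : i j p q / i <= j => [IH|].
  case: (lerP i j) => [ij|/ltW ij] e p0 q0; first exact: IH ij e p0 q0.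
  exact/esym/(IH _ _ _ _ ij (esym e)).
rewrite -(subrKC i j) tpowD -mulrA => /tpow_inj.
have : 0 <= j - i by rewrite subr_ge0.
case: (j - i) => // -[|n] _; first by rewrite addr0.
rewrite -lpolyXn -lpolyM => /lpoly_inj ->.
by rewrite hornerM hornerXn exprS !mul0r eqxx.
Qed.

(** Once [t^(i + j)] is taken out, the exponents enter only through [j - i]; this is the source of
    the left-hand side of [bracket_eq]. *)
Lemma bracket_lpoly i j p q :
  let F := tpow C i * lpoly p in let G := tpow C j * lpoly q in
  F * euler G - G * euler F =
  tpow C (i + j) * lpoly ((j - i)%:~R *: (p * q) + 'X * (p * q^`() - q * p^`())).
Proof.
rewrite /= !eulerM !euler_tpow !euler_lpoly tpowD intrB.
rewrite !(lpolyD, lpolyM, lpolyB, lpolyZ) lpolyX scalerBl.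
have sE (c : C) F : c *: F = c%:A * F by rewrite mulr_algl.
rewrite (sE _ (tpow C i)) (sE _ (tpow C j)) !(sE _ (lpoly p * lpoly q)).
ring.
Qed.

End LaurentPoly.

(** * Spans of two vectors *)

Section Span2.
Context (K : fieldType) (V : lmodType K).
Implicit Types u v w : V.

Lemma lspan2E u v w :
  lspan [:: u; v] w <-> exists x y, w = x *: u + y *: v.
Proof.
split=> [[c ->]|[x [y ->]]].
  by rewrite big_ord_recl big_ord1; exists (c ord0), (c (lift ord0 ord0)).
by exists (fun i => [:: x; y]`_i); rewrite big_ord_recl big_ord1.
Qed.

Lemma lfree2 u v x y :
  lfree [:: u; v] -> x *: u + y *: v = 0 -> x = 0 /\ y = 0.
Proof.
move=> free0 uv0.
have := free0 (fun i => [:: x; y]`_i).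
rewrite big_ord_recl big_ord1 => /(_ uv0) c0.
by split; [apply: (c0 ord0) | apply: (c0 (lift ord0 ord0))].
Qed.

Lemma lspan2_basis u v a b c d : a * d - b * c != 0 ->
  lspan [:: a *: u + b *: v; c *: u + d *: v] = lspan [:: u; v].
Proof.
move=> det0; apply/seteqP; split=> w /lspan2E [x [y ->]]; apply/lspan2E.
  exists (x * a + y * c), (x * b + y * d).
  by rewrite !scalerDr !scalerA !scalerDl addrACA.
(* Cramer's rule. *)
exists ((x * d - y * c) / (a * d - b * c)), ((y * a - x * b) / (a * d - b * c)).
rewrite !scalerDr !scalerA addrACA -!scalerDl.
by congr (_ *: _ + _ *: _); field.
Qed.

End Span2.

(** * Normal form of a basis *)

Section NormalForm.
Context (C : numFieldType).
Implicit Types (f g p q : {poly C}) (F G : laurent C) (i j : int).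

Lemma vfieldD2 (x y : C) F G :
  vfield (x *: F + y *: G) = x *: vfield F + y *: vfield G.
Proof.
apply/val_inj/funext => h.
change ((x *: F + y *: G) * euler h = x *: (F * euler h) + y *: (G * euler h)).
by rewrite mulrDl -!scalerAl.
Qed.

Lemma vfieldDZ (x : C) F G : vfield (F + x *: G) = vfield F + x *: vfield G.
Proof. by have := vfieldD2 1 x F G; rewrite !scale1r. Qed.

Lemma vfield0 : vfield (0 : laurent C) = 0.
Proof. by have := vfieldD2 0 0 0 0; rewrite !scale0r !addr0. Qed.

Lemma vfield1 : vfield (1 : laurent C) = partial.
Proof. by apply/val_inj/funext => h /=; rewrite mul1r. Qed.

Lemma lspan_vfield_shear (x : C) F G :
  lspan [:: vfield (F + x *: G); vfield G] = lspan [:: vfield F; vfield G].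
Proof.
rewrite vfieldDZ -[in RHS](@lspan2_basis _ _ _ _ 1 x 0 1).
  by rewrite !scale1r scale0r add0r.
by rewrite mulr1 mulr0 subr0 oner_eq0.
Qed.

Lemma lspan_vfield_scale (x y : C) F G : x != 0 -> y != 0 ->
  lspan [:: vfield (x *: F); vfield (y *: G)] = lspan [:: vfield F; vfield G].
Proof.
move=> x0 y0; rewrite -[in RHS](@lspan2_basis _ _ _ _ x 0 0 y).
  rewrite !scale0r addr0 add0r.
  have := vfieldD2 x 0 F G; rewrite !scale0r !addr0 => ->.
  by have := vfieldD2 0 y F G; rewrite !scale0r !add0r => ->.
by rewrite mulr0 subr0 mulf_neq0.
Qed.

Lemma bracket_shear (x : C) F G :
  (F + x *: G) * euler G - G * euler (F + x *: G) = F * euler G - G * euler F.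
Proof.
rewrite eulerD eulerZ mulrDl mulrDr opprD addrACA -scalerAl -scalerAr.
by rewrite subrr addr0.
Qed.

(** When the orders at 0 agree, [x] is chosen to cancel the lowest coefficient of [F] against that
    of [G]; the sum is nonzero by hypothesis and has a higher order. *)
Lemma separate_orders F G :
  (forall x, F + x *: G != 0) -> G != 0 ->
  exists x i j f g, [/\ F + x *: G = tpow C i * lpoly f,
    G = tpow C j * lpoly g, f.[0] != 0, g.[0] != 0 & i != j].
Proof.
move=> indep /laurent_factor[j [g [Gg g0]]].
have [i [f [Ff f0]]] : exists i p, F = tpow C i * lpoly p /\ p.[0] != 0.
  by apply: laurent_factor; have := indep 0; rewrite scale0r addr0.
have [ij|ij] := eqVneq i j; last first.
  by exists 0, i, j, f, g; rewrite scale0r addr0.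
pose x := - (f.[0] / g.[0]).
have Fx : F + x *: G = tpow C j * lpoly (f + x *: g).
  by rewrite lpolyD lpolyZ Ff Gg ij mulrDr -scalerAr.
have fx0 : f + x *: g != 0.
  by apply: contraNneq (indep x); rewrite Fx => ->; rewrite [lpoly 0]rmorph0 mulr0.
have [n [q [fq q0]]] := polyX_factor fx0.
exists x, (j + n%:Z), j, q, g; split; [|exact: Gg|exact: q0|exact: g0|].
  by rewrite Fx fq lpolyM lpolyXn tpowD -mulrA [_ * tpow C n]mulrC.
(* With [n = 0] the polynomial [q] would be [f + x *: g], whose value at 0 was made zero. *)
case: n fq => [fq|n _]; last by rewrite -subr_eq0 addrAC subrr add0r.
case/eqP: q0; have := congr1 (fun p => p.[0]) fq.
by rewrite /= expr0 mulr1 => <-; rewrite hornerD hornerZ mulNr divfK ?subrr.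
Qed.

Lemma order_bracket i j f g :
  (((j - i)%:~R *: (f * g) + 'X * (f * g^`() - g * f^`())).[0] : C)
  = (j - i)%:~R * (f.[0] * g.[0]).
Proof. by rewrite hornerD hornerZ !hornerM hornerX mul0r addr0. Qed.

(** After the orders are separated, the lowest coefficient of the bracket is [(j - i) f(0) g(0)],
    nonzero in characteristic 0. *)
Lemma bracket_neq0 F G :
  (forall x, F + x *: G != 0) -> G != 0 -> F * euler G - G * euler F != 0.
Proof.
move=> indep G0.
have [x [i [j [f [g [Ff Gg f0 g0 ij]]]]]] := separate_orders indep G0.
rewrite -(bracket_shear x) Ff Gg bracket_lpoly.
set p := (_ *: _ + _); have : p.[0] != 0.
  by rewrite order_bracket !mulf_neq0 // intr_eq0 subr_eq0 eq_sym.
apply: contraNneq; rewrite -(mulr0 (tpow C (i + j))) => /tpow_inj.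
by rewrite -(rmorph0 (@lpoly C)) => /lpoly_inj ->; rewrite horner0.
Qed.

(** The bracket of two basis vectors is nonzero and spans the derived algebra; up to a scalar it
    serves as the new [G]. *)
Lemma nonabelian_basis (A : set (der (laurent C))) :
  lie_subalgebra A -> has_dim A 2 ->
  exists F G (lam : C), [/\ lam != 0, G != 0, forall x, F + x *: G != 0,
    A = lspan [:: vfield F; vfield G] & F * euler G - G * euler F = lam *: G].
Proof.
move=> [_ _ lieA] [[|D [|E [|? ?]]] [] // _ free AE]; rewrite {A}AE in lieA *.
have [F DF] := vfield_surj D; have [G EG] := vfield_surj E; subst D E.
have [x [y]] : exists x y, lie (vfield F) (vfield G) = x *: vfield F + y *: vfield G.
  apply/lspan2E/lieA; apply/lspan2E; first by exists 1, 0; rewrite scale1r scale0r addr0.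
  by exists 0, 1; rewrite scale1r scale0r add0r.
rewrite lie_vfield -vfieldD2 => /vfield_inj bracket.
have indep a b : a *: F + b *: G = 0 -> a = 0 /\ b = 0.
  by move=> ab0; apply: lfree2 free _; rewrite -vfieldD2 ab0 vfield0.
have FG z : F + z *: G != 0.
  apply/eqP => e; have [|/eqP] := @indep 1 z; first by rewrite scale1r.
  by rewrite oner_eq0.
have GF z : G + z *: F != 0.
  apply/eqP => e; have [|_ /eqP] := @indep z 1; first by rewrite scale1r addrC.
  by rewrite oner_eq0.
have F0 : F != 0 by have := FG 0; rewrite scale0r addr0.
have G0 : G != 0 by have := GF 0; rewrite scale0r addr0.
(* For [y = 0] the bracket is [x *: F], so [F] and [G] exchange roles and the sign changes.
   Otherwise [G] is replaced by the bracket itself, and [[F, x F + y G] = y [F, G]]. *)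
have [y0|y0] := eqVneq y 0.
  have x0 : x != 0.
    apply: contraNneq (bracket_neq0 FG G0) => x0.
    by rewrite bracket x0 y0 !scale0r addr0.
  exists G, F, (- x); split=> //; first by rewrite oppr_eq0.
    rewrite -[LHS](@lspan2_basis _ _ _ _ 0 1 1 0).
      by rewrite !scale0r !scale1r addr0 add0r.
    by rewrite !mulr1 mulr0 sub0r oppr_eq0 oner_eq0.
  by rewrite scaleNr -[x *: F]addr0 -(scale0r G) -y0 -bracket opprB.
exists F, (x *: F + y *: G), y; split; first exact: y0.
- by apply/eqP => /indep [_ /eqP]; rewrite (negPf y0).
- move=> z; apply/eqP => e; have [|/eqP zx /eqP] := @indep (1 + z * x) (z * y).
    by rewrite -[RHS]e scalerDr !scalerA scalerDl scale1r addrA.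
  rewrite mulf_eq0 (negPf y0) orbF => /eqP z0; move: zx.
  by rewrite z0 mul0r addr0 oner_eq0.
- rewrite -[LHS](@lspan2_basis _ _ _ _ 1 0 x y).
    by rewrite vfieldD2 scale1r scale0r addr0.
  by rewrite mul1r mul0r subr0.
rewrite -[in RHS]bracket eulerD !eulerZ.
rewrite mulrDr mulrDl -!scalerAl -!scalerAr opprD addrACA subrr add0r.
by rewrite scalerBr.
Qed.

Lemma normal_form (A : set (der (laurent C))) :
  lie_subalgebra A -> has_dim A 2 ->
  exists j f g (lam : C), [/\ j != 0, lam != 0, f.[0] != 0 & g.[0] != 0] /\
    A = lspan [:: vfield (lpoly f); vfield (tpow C j * lpoly g)] /\
    bracket_eq j f g lam.
Proof.
move=> lieA dimA.
have [F [G [lam [lam0 G0 indep -> bracket]]]] := nonabelian_basis lieA dimA.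
have [x [i [j [f [g [Ff Gg f0 g0 ij]]]]]] := separate_orders indep G0.
move: bracket; rewrite -(bracket_shear x) -(lspan_vfield_shear x) Ff Gg.
rewrite bracket_lpoly [RHS]scalerAr -lpolyZ => e.
(* The bracket has order [i + j] at 0, because [i] and [j] differ, while [lam *: G] has order
   [j]. *)
have i0 : i = 0.
  apply: (@addIr _ j); rewrite add0r; apply: laurent_factor_uniq e _ _.
    by rewrite order_bracket !mulf_neq0 // intr_eq0 subr_eq0 eq_sym.
  by rewrite hornerZ mulf_neq0.
move: e ij; rewrite {}i0 add0r subr0 tpow0 mul1r => /tpow_inj /lpoly_inj e ij.
by exists j, f, g, lam; rewrite eq_sym ij.
Qed.

End NormalForm.

(** * Classification *)

Section Assembly.
Context (C : numFieldType).

Lemma lpolyXsubC (b : C) : lpoly ('X - b%:P) = tpow C 1 - b%:A.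
Proof. by rewrite lpolyB lpolyX lpolyC. Qed.

Lemma lpoly_prod (T : Type) (s : seq T) (F : T -> {poly C}) :
  lpoly (\prod_(b <- s) F b) = \prod_(b <- s) lpoly (F b).
Proof. exact: rmorph_prod. Qed.

Lemma Sigma_of_roots w (s1 s2 : seq C) (mu : C -> nat) : (0 < w)%N ->
  0 \notin s1 ++ s2 -> {in s1, forall b, (1 < mu b)%N} ->
  {in s2, forall b, mu b = 0%N} ->
  \sum_(b <- s1 ++ s2) ((mu b)%:Z - 1) = w%:Z -> (size s1 <= w)%N ->
  (forall i, (1 <= i <= (size (s1 ++ s2)).-1)%N ->
    \sum_(b <- s1 ++ s2) ((mu b)%:Z - 1)%:~R * b ^+ i = 0) ->
  exists m : Sigma C,
    Pmu m = lpoly (\prod_(b <- s1 ++ s2) ('X - b%:P)) /\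
    Qmu m = tpow C (- w%:Z) * lpoly (\prod_(b <- s1) ('X - b%:P) ^+ mu b).
Proof.
move=> w_gt0 s0 mu_s1 mu_s2 sum_w s1w sum0.
pose s := s1 ++ s2; pose r := \row_(j < size s) ((mu s`_j)%:Z - 1).
pose a := \row_(j < size s) s`_j.
have weightE : weight r = w%:Z.
  by rewrite -sum_w (big_nth 0) big_mkord; apply: eq_bigr => j _; rewrite mxE.
have nth_s1 j : (j < size s1)%N -> s`_j \in s1.
  by move=> js1; rewrite nth_cat js1 mem_nth.
(* With [s1] empty every summand [mu b - 1] would be [-1], and the sum could not be the positive
   [w]. *)
have k_gt0 : (0 < size s1)%N.
  rewrite lt0n; apply: contraTneq w_gt0 => /eqP; rewrite size_eq0 => /eqP s1_nil.
  rewrite -ltz_nat -sum_w s1_nil /= -leNgt big_seq sumr_le0 // => b bs2.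
  by rewrite mu_s2.
have k_le_n : (size s1 <= size s)%N by rewrite size_cat leq_addr.
have r_Gamma : Gamma (size s1) r.
  split=> [j js1|j js1|]; last by rewrite weightE lez_nat.
    by rewrite mxE subr_gt0 ltz_nat mu_s1 ?nth_s1.
  rewrite mxE mu_s2 ?sub0r // nth_cat ltnNge js1 /= mem_nth //.
  by rewrite ltn_subLR // -size_cat.
have a_V : Vtimes r a.
  split=> [i i1n|j]; last first.
    by rewrite mxE; apply: contraNneq s0 => <-; rewrite mem_nth.
  rewrite -[RHS](sum0 i i1n) [RHS](big_nth 0) big_mkord.
  by apply: eq_bigr => j _; rewrite !mxE.
exists (Build_Sigma k_gt0 k_le_n r_Gamma a_V); split.
  rewrite /Pmu /= lpoly_prod [RHS](big_nth 0) big_mkord.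
  by apply: eq_bigr => j _; rewrite mxE lpolyXsubC.
rewrite /Qmu /= weightE lpoly_prod /= [in RHS](big_nth 0) big_mkord.
congr (_ * _).
rewrite (big_ord_widen _ (fun j => lpoly (('X - (s1`_j)%:P) ^+ mu s1`_j)) k_le_n).
apply: eq_bigr => j js1; rewrite !mxE subrK.
by rewrite [lpoly _]rmorphXn /= lpolyXsubC /s nth_cat js1.
Qed.

(** The equation reads [(j + k) x g_k = lam g_k] for every [k]. At [k = 0] it gives [lam = j x], and
    then [g_k = 0] for all [k > 0], so [g] is constant. *)
Lemma z_alg_of_const (j : int) (x : C) (g : {poly C}) lam :
  x != 0 -> g.[0] != 0 -> bracket_eq j x%:P g lam ->
  lspan [:: vfield (lpoly x%:P); vfield (tpow C j * lpoly g)] = z_alg j.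
Proof.
move=> x0 g0 e.
have coefE k : (j%:~R + k%:R) * x * g`_k = lam * g`_k.
  have := congr1 (fun p : {poly C} => p`_k) e.
  rewrite /= derivC mulr0 subr0 mulrCA coefD !coefZ !coefCM coef_mulX_deriv => <-.
  ring.
have lamE : lam = j%:~R * x.
  apply: (@mulIf _ g`_0); first by rewrite -horner_coef0.
  by rewrite -coefE addr0.
have gE : g = g.[0]%:P.
  apply/polyP => k; rewrite coefC horner_coef0; case: k => [|k] //=.
  have /eqP : k.+1%:R * x * g`_k.+1 = 0.
    transitivity ((j%:~R + k.+1%:R) * x * g`_k.+1 - lam * g`_k.+1).
      by rewrite lamE; ring.
    by rewrite coefE subrr.
  by rewrite !mulf_eq0 pnatr_eq0 (negPf x0) /= => /eqP.
by rewrite gE !lpolyC -scalerAr mulr1 lspan_vfield_scale // vfield1.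
Qed.

End Assembly.

(** * Case distinction on the exponent [j] *)

Section Main.
Context (C : numClosedFieldType).

Lemma two_dim_subalgebra (A : set (der (laurent C))) :
  lie_subalgebra A -> has_dim A 2 ->
  (exists m : int, m != 0 /\ A = z_alg m) \/ (exists mu : Sigma C, A = s_alg mu).
Proof.
move=> lieA dimA.
have [j [f [g [lam [[j0 lam0 f00 g00] [-> e]]]]]] := normal_form lieA dimA.
have f0 : f != 0 by apply: contraNneq f00 => ->; rewrite horner0.
have g0 : g != 0 by apply: contraNneq g00 => ->; rewrite horner0.
have const p : p.[0] != 0 -> (size p <= 1)%N -> bracket_eq j p g lam ->
    lspan [:: vfield (lpoly p); vfield (tpow C j * lpoly g)] = z_alg j.
  move=> p00 /size1_polyC pE; rewrite pE => ep; apply: z_alg_of_const ep => //.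
  by rewrite -horner_coef0.
have [f1|f1] := leqP (size f) 1; first by left; exists j; split=> //; exact: const.
have sfg := bracket_eq_size f0 g0 f1 e.
case: j j0 e const sfg => [[|n]|n] // _ e const sfg.
  left; exists n.+1%:Z; split=> //.
  (* Here [j = n + 1 > 0] and [deg f = j + deg g], so this [x] cancels the top coefficient of [f]
     against [t^j g], while the value at 0 is unchanged. *)
  pose x := - (lead_coef f / lead_coef g).
  pose h := f + x *: ('X^(n.+1) * g).
  rewrite -(lspan_vfield_shear x) -lpolyXn -lpolyM -lpolyZ -lpolyD lpolyM lpolyXn.
  have h00 : h.[0] != 0.
    by rewrite hornerD hornerZ hornerM hornerXn exprS !mul0r mulr0 addr0.
  have h0 : h != 0 by apply: contraNneq h00 => ->; rewrite horner0.
  have eh : bracket_eq n.+1 h g lam.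
    rewrite /bracket_eq -e /h derivD derivZ derivM derivXn -!mul_polyC /=.
    rewrite rmorphMz /= -mulr_natl exprS; ring.
  (* A nonconstant [h] would satisfy the same degree relation as [f] and so have the degree of [f],
     where its coefficient is zero by the choice of [x]. *)
  apply: const => //; rewrite leqNgt; apply/negP => h1.
  have := bracket_eq_size h0 g0 h1 eh; rewrite -sfg => -[size_h].
  have /eqP : lead_coef h = 0.
    rewrite lead_coefE size_h coefD coefZ coefXnM.
    have sf : size f = (n.+1 + size g)%N by move: (size f) (size g) sfg; clear; lia.
    have g_gt0 : (0 < size g)%N by rewrite size_poly_gt0.
    rewrite ifF; last by rewrite sf; move: (size g) g_gt0; clear; lia.
    have -> : ((size f).-1 - n.+1 = (size g).-1)%N.
      by rewrite sf; move: (size g) g_gt0; clear; lia.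
    by rewrite -!lead_coefE mulNr divfK ?lead_coef_eq0 // subrr.
  by rewrite lead_coef_eq0 (negPf h0).
(* Now [j = -(n + 1)], so [w = n + 1]; the leading coefficients of [f] and [g] only rescale the
   basis. *)
right; rewrite NegzE in e *.
have [s1 [s2 [mu [[fE gE s0 mu1 mu2] [sum_w s1w sum0]]]]] :=
  bracket_eq_roots (ltn0Sn n) lam0 f00 g00 f1 e.
have [m [Pm Qm]] := Sigma_of_roots (ltn0Sn n) s0 mu1 mu2 sum_w s1w sum0.
exists m; rewrite /s_alg Pm Qm {1}fE {1}gE !lpolyZ -scalerAr.
by rewrite lspan_vfield_scale ?lead_coef_eq0.
Qed.

End Main.

Theorem theorem3p3 (R : realType) (a : set (der (laurent R[i]))) :
  lie_subalgebra a -> has_dim a 2 ->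
  (exists m : int, m != 0 /\ a = z_alg m) \/
  (exists mu : Sigma R[i], a = s_alg mu).
Proof. exact: two_dim_subalgebra. Qed.
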